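(* Let $D$ be an integral domain. Then the following conditions are equivalent. (a) $D$ is a GL-domain. (b) Each nonzero nonunit element of $D$ is prime-like.
   Context: Let $D$ be an integral domain with group of units $D^\times$. A nonzero polynomial $f \in D[X]$ is called primitive over $D$ if the ideal $I_f$ of $D$ generated by the coefficients of $f$ is not contained in any proper principal ideal of $D$; equivalently, the only common divisors in $D$ of the coefficients of $f$ are the units of $D$. The domain $D$ is a GL-domain if the product of any two primitive polynomials over $D$ is again primitive over $D$. A nonzero nonunit $p \in D$ is called prime-like if for all $r,s \in D$ such that $p$ divides $rs$ in $D$, there exists a divisor $d \in D \setminus D^\times$ of $p$ such that $d$ divides $r$ in $D$ or $d$ divides $s$ in $D$. *)

(* Defs.v *)
From mathcomp Require Import all_boot all_algebra.

Set Implicit Arguments.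
Unset Strict Implicit.
Unset Printing Implicit Defensive.

Import GRing.Theory.
Local Open Scope ring_scope.

(* Divisibility and ideals are Prop-valued, as they need not be decidable in
   an arbitrary integral domain; the Boolean [a %| b] of MathComp is only
   available for nat, int and polynomials. *)
Definition divides (D : idomainType) (a b : D) : Prop :=
  exists c : D, b = c * a.

Definition principal_ideal (D : idomainType) (d : D) : D -> Prop :=
  fun x => divides d x.

Definition coef_ideal (D : idomainType) (f : {poly D}) : D -> Prop :=
  fun x => exists c : 'I_(size f) -> D, x = \sum_(i < size f) c i * f`_i.

Definition ideal_sub (D : idomainType) (I J : D -> Prop) : Prop :=
  forall x : D, I x -> J x.

Definition proper_ideal (D : idomainType) (I : D -> Prop) : Prop :=
  exists x : D, ~ I x.

Definition primitive (D : idomainType) (f : {poly D}) : Prop :=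
  f != 0 /\
  forall d : D, proper_ideal (principal_ideal d) ->
    ~ ideal_sub (coef_ideal f) (principal_ideal d).

Definition GL_domain (D : idomainType) : Prop :=
  forall f g : {poly D}, primitive f -> primitive g -> primitive (f * g).

Definition prime_like (D : idomainType) (p : D) : Prop :=
  [/\ p != 0, p \isn't a GRing.unit &
    forall r s : D, divides p (r * s) ->
      exists d : D, [/\ divides d p, d \isn't a GRing.unit &
                        divides d r \/ divides d s]].

(* Main.v *)
Require Import Defs.
From mathcomp Require Import all_boot all_algebra ring.
From Stdlib Require Import Classical.

Import GRing.Theory.
Local Open Scope ring_scope.

(** If p divides rs but no nonunit divisor of p divides r or s, then p + rX and
    p + sX are primitive while p divides every coefficient of their product.
    Conversely, suppose that a nonzero nonunit c divides fg.  Then c divides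
    f(0)g(0), so some nonunit divisor d of c divides f(0), say; now d divides
    (f - f(0))g, hence ((f - f(0))/X)g, and an induction on f and g yields a
    nonunit divisor of c that divides all of f or all of g. *)

Section Divisibility.

Context {D : idomainType}.
Implicit Types (a b c d : D) (f g : {poly D}).

Lemma divides_refl a : divides a a.
Proof. by exists 1; rewrite mul1r. Qed.

Lemma divides_trans b a c : divides a b -> divides b c -> divides a c.
Proof. by move=> [x ->] [y ->]; exists (y * x); rewrite mulrA. Qed.

Lemma divides0 a : divides a 0.
Proof. by exists 0; rewrite mul0r. Qed.

Lemma dividesD d a b : divides d a -> divides d b -> divides d (a + b).
Proof. by move=> [x ->] [y ->]; exists (x + y); rewrite mulrDl. Qed.

Lemma dividesB d a b : divides d a -> divides d b -> divides d (a - b).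
Proof. by move=> [x ->] [y ->]; exists (x - y); rewrite mulrBl. Qed.

Lemma divides_mull d a b : divides d b -> divides d (a * b).
Proof. by move=> [x ->]; exists (a * x); rewrite mulrA. Qed.

Lemma divides_mulr d a b : divides d a -> divides d (a * b).
Proof. by rewrite mulrC; apply: divides_mull. Qed.

Lemma divides_neq0 d a : divides d a -> a != 0 -> d != 0.
Proof. by move=> [x ->]; rewrite mulf_eq0 negb_or => /andP[]. Qed.

Lemma proper_principalP d :
  Defs.proper_ideal (principal_ideal d) <-> d \isn't a GRing.unit.
Proof.
split=> [[x dx]|nud].
  by apply/negP => ud; apply: dx; exists (x / d); rewrite divrK.
by exists 1 => -[x /esym xd1]; case/unitrP: nud; exists x; rewrite [d * x]mulrC xd1.
Qed.

(** Letting [i] range over all naturals is harmless, as coefficients past the degree are 0, and it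
    avoids range conditions when indices shift. *)
Definition divides_coefs d f := forall i, divides d f`_i.

Lemma coef_ideal_subP f d :
  ideal_sub (coef_ideal f) (principal_ideal d) <-> divides_coefs d f.
Proof.
split=> [sub i|df x [c ->]].
  have [lt_i|le_i] := ltnP i (size f); last first.
    by rewrite nth_default //; apply: divides0.
  apply: sub; exists (fun j => (j == Ordinal lt_i)%:R).
  rewrite (bigD1 (Ordinal lt_i)) //= eqxx mul1r big1 ?addr0 //= => j /negPf ->.
  by rewrite mul0r.
apply: (big_ind (principal_ideal d)); first exact: divides0.
  exact: dividesD.
by move=> i _; apply: divides_mull.
Qed.

Lemma primitiveP f :
  primitive f <->
  f != 0 /\ forall d, divides_coefs d f -> d \is a GRing.unit.
Proof.
split=> -[f0 prim_f]; split=> // d.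
  move=> /coef_ideal_subP sub; apply/negPn/negP => /proper_principalP.
  by move=> /prim_f /(_ sub).
by move=> /proper_principalP nud /coef_ideal_subP /prim_f; apply/negP.
Qed.

Lemma divides_coefs_trans c d f :
  divides d c -> divides_coefs c f -> divides_coefs d f.
Proof. by move=> dc cf i; apply: divides_trans dc (cf i). Qed.

Lemma divides_coefs_neq0 d f : divides_coefs d f -> f != 0 -> d != 0.
Proof.
(* The leading coefficient is a nonzero multiple of [d]. *)
by move=> df f0; apply: divides_neq0 (df (size f).-1) _; rewrite lead_coef_eq0.
Qed.

Lemma divides_coefs_consX d f a :
  divides_coefs d f -> divides d a -> divides_coefs d (f * 'X + a%:P).
Proof.
by move=> df da [|i]; rewrite coefD coefMX coefC /= ?add0r ?addr0.
Qed.

(** Removing [a] changes the product by [a * g], whose coefficients [d] divides; cancelling ['X]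
    only shifts indices. *)
Lemma divides_coefs_consX_mul d f a g :
  divides d a -> divides_coefs d ((f * 'X + a%:P) * g) ->
  divides_coefs d (f * g).
Proof.
move=> da dfg i.
have -> : (f * g)`_i = ((f * 'X + a%:P) * g)`_i.+1 - a * g`_i.+1.
  by rewrite mulrDl mulrAC coefD coefMX coefCM addrK.
by apply: dividesB; [apply: dfg | apply: divides_mulr].
Qed.

Lemma primitive_linear (p r : D) :
  p != 0 ->
  (forall d, divides d p -> divides d r -> d \is a GRing.unit) ->
  primitive (r *: 'X + p%:P).
Proof.
move=> p0 pr; have c0 : (r *: 'X + p%:P)`_0%N = p.
  by rewrite coefD coefZ coefX coefC mulr0 add0r.
apply/primitiveP; split.
  by apply: contra_neq p0 => f0; rewrite -c0 f0 coef0.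
move=> d df; apply: pr; first by move: (df 0%N); rewrite c0.
by move: (df 1%N); rewrite coefD coefZ coefX coefC mulr1 addr0.
Qed.

Lemma GL_domain_prime_like (p : D) :
  GL_domain D -> p != 0 -> p \isn't a GRing.unit -> prime_like p.
Proof.
move=> GL p0 nup; split=> // r s prs; apply: NNPP => no_d.
(* A nonunit common divisor of [p] and [t] would be the divisor that [no_d] excludes. *)
have prim t : (t = r \/ t = s) -> primitive (t *: 'X + p%:P).
  move=> tE; apply: primitive_linear => // d dp dt.
  apply/negPn/negP => nud; apply: no_d; exists d; split=> //.
  by case: tE dt => ->; [left | right].
have /primitiveP[_ units] :=
  GL _ _ (prim r (or_introl erefl)) (prim s (or_intror erefl)).
case/negP: nup; apply: units => i.
have -> : (r *: 'X + p%:P) * (s *: 'X + p%:P) =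
    (r * s) *: 'X^2 + p *: (r *: 'X + s *: 'X + p%:P).
  by rewrite -!mul_polyC polyCM; ring.
rewrite coefD !coefZ; apply: dividesD; first exact: divides_mulr.
exact/divides_mulr/divides_refl.
Qed.

(** The element [c] stays universally quantified because each inductive step replaces it by a
    nonunit divisor. *)
Lemma prime_like_divides_coefs_mul :
  (forall p : D, p != 0 -> p \isn't a GRing.unit -> prime_like p) ->
  forall f g c, c != 0 -> c \isn't a GRing.unit -> divides_coefs c (f * g) ->
  exists d, [/\ divides d c, d \isn't a GRing.unit &
                divides_coefs d f \/ divides_coefs d g].
Proof.
move=> PL; elim/poly_ind => [|f a IHf] g.
  move=> c _ nuc _; exists c; split=> //; first exact: divides_refl.
  by left=> i; rewrite coef0; apply: divides0.
(* The inner induction fixes the left factor [f * 'X + a%:P], while [IHf] remains available for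
   every right factor. *)
elim/poly_ind: g => [|g b IHg] c c0 nuc cfg.
  exists c; split=> //; first exact: divides_refl.
  by right=> i; rewrite coef0; apply: divides0.
have [_ _ /(_ a b)[|d [dc nud dab]]] := PL c c0 nuc.
  (* The constant coefficient of the product is [a * b]. *)
  by move: (cfg 0%N); rewrite coef0M !coefD !coefMX !coefC !add0r.
have d0 := divides_neq0 _ _ dc c0.
have dfg := divides_coefs_trans _ _ _ dc cfg.
case: dab => [da|db].
  have [e [ed nue efg]] :=
    IHf _ d d0 nud (divides_coefs_consX_mul _ _ _ _ da dfg).
  exists e; split=> //; first exact: divides_trans ed dc.
  case: efg => [ef|eg]; [left | by right].
  (* Since [e] divides [d], it also divides [a], so the constant term can be restored. *)
  exact/divides_coefs_consX/(divides_trans _ _ _ ed da).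
move: dfg; rewrite mulrC => /(divides_coefs_consX_mul _ _ _ _ db).
rewrite mulrC => /(IHg d d0 nud)[e [ed nue efg]].
exists e; split=> //; first exact: divides_trans ed dc.
case: efg => [ef|eg]; [by left | right].
exact/divides_coefs_consX/(divides_trans _ _ _ ed db).
Qed.

End Divisibility.

Theorem proposition3p3 (D : idomainType) :
  GL_domain D <->
  (forall p : D, p != 0 -> p \isn't a GRing.unit -> prime_like p).
Proof.
split=> [GL p|PL f g /primitiveP[f0 uf] /primitiveP[g0 ug]].
  exact: GL_domain_prime_like.
have fg0 : f * g != 0 by rewrite mulf_neq0.
apply/primitiveP; split=> // c cfg; apply/negPn/negP => nuc.
(* A nonunit dividing all of [f] or all of [g] contradicts primitivity. *)
have [d [_ /negP nud]] := prime_like_divides_coefs_mul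
  PL f g c (divides_coefs_neq0 _ _ cfg fg0) nuc cfg.
by case=> [/uf|/ug].
Qed.
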